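(* Let $\mathsf R$ be an operad with associated groupoids $C_n$ and simplicial groupoid $D_\bullet$. There is a canonical equivalence of groupoids $$C_2\simeq\int^{w\in D_0}(D_1)_w\times{}_w(C_1).$$ This equivalence is over $D_1\times C_1$ and hence also over $D_1\times D_1$.
   Context: **Conventions.** $\mathbf{Grpd}$ is the 2-category of groupoids, $\mathbf{Grpd}/I$ the strict slice, $\mathbf{Grpd}_{/I}$ the weak slice (triangles commuting up to specified isomorphism). A polynomial of groupoids $I\xleftarrow{s}E\xrightarrow{p}B\xrightarrow{t}J$, with $p$ a fibration, defines the polynomial functor $t_!\circ p_*\circ s^*:\mathbf{Grpd}/I\to\mathbf{Grpd}/J$ ($s^*$ is pullback, $t_!$ postcomposition, $p_*$ right adjoint to $p^*$). For a groupoid-indexed family $(E_b)_{b\in B}$, the homotopy sum is $\int^{b\in B}E_b:=\sum_{b\in\pi_0B}E_b/\mathrm{Aut}(b)$, with $/$ the homotopy quotient (action groupoid). $\mathbb B$ is the groupoid of finite sets and bijections, $\mathbb B'$ the groupoid of finite pointed sets and basepoint-preserving bijections, $\underline n$ the fibre of $\mathbb B'\to\mathbb B$ over $n$. $\mathsf S:\mathbf{Grpd}\to\mathbf{Grpd}$ is the symmetric monoidal category monad, represented by $1\leftarrow\mathbb B'\to\mathbb B\to1$, so $\mathsf S(X)=\int^{n\in\mathbb B}\mathrm{Map}(\underline n,X)$; its unit $\eta^{\mathsf S}$ is the inclusion of singleton families and its multiplication $\mu^{\mathsf S}$ is concatenation of families. **Operads.** An operad means a coloured symmetric operad in sets; it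 is identified with a polynomial monad $\mathsf R$ on $\mathbf{Grpd}/I$ represented by $I\leftarrow E\to B\to I$, together with a cartesian monad map to $\mathsf S$ over $F:I\to1$ (maps $E\to\mathbb B'$, $B\to\mathbb B$ forming a pullback square with $E\to B$ and $\mathbb B'\to\mathbb B$, compatibly with the monad structures), where $I$ is a set and $B\to\mathbb B$ is a discrete fibration. Here $I$ is the set of colours, $B$ the disjoint union over $n$ of the action groupoids of the symmetric groups $\mathfrak S_n$ on the sets of $n$-ary operations, $E$ the groupoid of operations with a marked input slot, $E\to I$ gives the colour of the marked slot, $B\to I$ gives the output colour; the monad structure is operad substitution. $F_!:\mathbf{Grpd}/I\to\mathbf{Grpd}$ is the forgetful functor, and $\phi:F_!\mathsf R\Rightarrow\mathsf SF_!$ is the induced cartesian natural transformation, making $(F_!,\phi)$ a monad opfunctor. **Bar construction.** $A$ is the terminal object of $\mathbf{Grpd}/I$ and $\alpha:\mathsf RA\to A$ the unique map (terminal $\mathsf R$-algebra). Put $C_n:=F_!\mathsf R^nA$ and $D_n:=\mathsf S C_n$; thus $C_0=I$, $C_1=B$. The maps $d_k:C_{n+1}\to C_n$ ($0\le k\le n$) are $F_!\mathsf R^{n-k}\mu_{\mathsf R^{k-1}A}$ with the convention $\mu_{\mathsf R^{-1}A}=\alpha$, and $s_k:C_n\to C_{n+1}$ are $F_!\mathsf R^{n-k}\eta_{\mathsf R^kA}$. Applying $\mathsf S$ to these and adding the top face maps $d_{n+1}:=\mu^{\mathsf S}_{C_n}\circ\mathsf S(\phi_{\mathsf R^nA}):D_{n+1}\to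 D_n$ gives a simplicial groupoid $D_\bullet$. **Fibres and structure maps.** $(D_1)_w$ is the homotopy fibre over $w\in D_0$ of $d_0:D_1\to D_0$; ${}_w(C_1)$ is the homotopy fibre over $w$ of $C_1\xrightarrow{\eta^{\mathsf S}}D_1\xrightarrow{d_1}D_0$. The map $C_2\to D_1\times C_1$ is $(d_2\circ\eta^{\mathsf S}_{C_2},\,d_0)$, and $C_1$ maps to $D_1$ by $\eta^{\mathsf S}_{C_1}$; the homotopy sum maps to $D_1\times C_1$ via $(D_1)_w\times{}_w(C_1)\to D_1\times C_1$. *)

(* Defs.v *)
From mathcomp Require Import all_boot order.
From mathcomp Require Import boolp.

Set Implicit Arguments.
Unset Strict Implicit.
Unset Printing Implicit Defensive.

(** * Groupoids, functors, natural isomorphisms *)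

(* [comp g f] is "g after f". *)
Record groupoid : Type := Groupoid {
  ob :> Type;
  hom : ob -> ob -> Type;
  idm : forall x, hom x x;
  comp : forall x y z, hom y z -> hom x y -> hom x z;
  inv : forall x y, hom x y -> hom y x;
  comp1m : forall x y (f : hom x y), comp (idm y) f = f;
  compm1 : forall x y (f : hom x y), comp f (idm x) = f;
  compA : forall x y z t (h : hom z t) (g : hom y z) (f : hom x y),
    comp h (comp g f) = comp (comp h g) f;
  invm : forall x y (f : hom x y), comp (inv f) f = idm x;
  minv : forall x y (f : hom x y), comp f (inv f) = idm y }.

Arguments hom {_} x y.
Arguments idm {_} x.
Arguments comp {_ x y z} _ _.
Arguments inv {_ x y} _.

Record functor (C D : groupoid) : Type := Functor {
  fob :> C -> D;
  fhom : forall x y, hom x y -> hom (fob x) (fob y);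
  fhom1 : forall x, fhom (idm x) = idm (fob x);
  fhomM : forall x y z (g : hom y z) (f : hom x y),
    fhom (comp g f) = comp (fhom g) (fhom f) }.

Arguments fhom {C D} _ {x y} _.

Record nat_iso (C D : groupoid) (F G : functor C D) : Type := NatIso {
  nat_at :> forall x, hom (F x) (G x);
  nat_comm : forall x y (f : hom x y),
    comp (nat_at y) (fhom F f) = comp (fhom G f) (nat_at x) }.

Lemma id_functor_subproof (C : groupoid) (x y z : C) (g : hom y z)
  (f : hom x y) : comp g f = comp g f.
Proof. by []. Qed.

Definition id_functor (C : groupoid) : functor C C :=
  @Functor C C (fun x => x) (fun x y f => f) (fun x => erefl)
    (@id_functor_subproof C).

Section ComposeFunctors.
Variables (C D E : groupoid) (G : functor D E) (F : functor C D).

Lemma comp_functor1 x : fhom G (fhom F (idm x)) = idm (G (F x)).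
Proof. by rewrite !fhom1. Qed.

Lemma comp_functorM x y z (g : hom y z) (f : hom x y) :
  fhom G (fhom F (comp g f)) = comp (fhom G (fhom F g)) (fhom G (fhom F f)).
Proof. by rewrite !fhomM. Qed.

Definition comp_functor : functor C E :=
  @Functor C E (fun x => G (F x)) (fun x y f => fhom G (fhom F f))
    comp_functor1 comp_functorM.

End ComposeFunctors.

Notation "G ∘ F" := (comp_functor G F) (at level 40, left associativity).

Definition is_equivalence (C D : groupoid) (F : functor C D) : Prop :=
  exists G : functor D C,
    inhabited (nat_iso (G ∘ F) (id_functor C)) /\
    inhabited (nat_iso (F ∘ G) (id_functor D)).

Definition hom_of_eq (C : groupoid) (x y : C) (e : x = y) : hom x y :=
  match e with erefl => idm x end.

Lemma hom_of_eq1 (C : groupoid) (x : C) (e : x = x) : hom_of_eq e = idm x.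
Proof. by rewrite (Prop_irrelevance e erefl). Qed.

Lemma map_hom_of_eq (C D : groupoid) (F : functor C D) x y (e : x = y) :
  fhom F (hom_of_eq e) = hom_of_eq (f_equal F e).
Proof. by case: _ / e; rewrite /= fhom1. Qed.

Lemma comp_hom_of_eq (C : groupoid) (x y z : C) (e' : y = z) (e : x = y) :
  comp (hom_of_eq e') (hom_of_eq e) = hom_of_eq (etrans e e').
Proof. by case: _ / e' ; case: _ / e; rewrite /= comp1m. Qed.

Lemma functor_eq_nat (C D : groupoid) (F G : functor C D) (e : F = G)
    (x y : C) (f : hom x y) (ex : F x = G x) (ey : F y = G y) :
  comp (hom_of_eq ey) (fhom F f) = comp (fhom G f) (hom_of_eq ex).
Proof.
by case: _ / e ex ey => ex ey; rewrite !hom_of_eq1 comp1m compm1.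
Qed.

Lemma functor_eq (C D : groupoid) (F G : functor C D)
    (e : forall x, F x = G x) :
  (forall x y (f : hom x y),
     comp (hom_of_eq (e y)) (fhom F f) = comp (fhom G f) (hom_of_eq (e x))) ->
  F = G.
Proof.
case: F G e => [F Fh F1 FM] [G Gh G1 GM] /= e.
have eFG : F = G by apply: funext.
case: _ / eFG Gh G1 GM e => Gh G1 GM e eh.
have ehom : Fh = Gh.
  apply: functional_extensionality_dep => x.
  apply: functional_extensionality_dep => y.
  apply: funext => f; have := eh x y f.
  by rewrite !hom_of_eq1 comp1m compm1.
case: _ / ehom G1 GM {eh} => G1 GM.
by rewrite (Prop_irrelevance F1 G1) (Prop_irrelevance FM GM).
Qed.

Definition discrete (I : Type) : groupoid.
Proof.
refine (@Groupoid I (fun i j => i = j) (fun i => erefl)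
  (fun i j k g f => etrans f g) (fun i j f => esym f) _ _ _ _ _);
  abstract (by move=> *; apply: Prop_irrelevance).
Defined.

Definition prod_groupoid (C D : groupoid) : groupoid.
Proof.
refine (@Groupoid (C * D)%type
  (fun x y => (hom x.1 y.1 * hom x.2 y.2)%type)
  (fun x => (idm x.1, idm x.2))
  (fun x y z g f => (comp g.1 f.1, comp g.2 f.2))
  (fun x y f => (inv f.1, inv f.2)) _ _ _ _ _).
- abstract (by move=> x y [f1 f2] /=; rewrite !comp1m).
- abstract (by move=> x y [f1 f2] /=; rewrite !compm1).
- abstract (by move=> x y z t h g f /=; rewrite !compA).
- abstract (by move=> x y f /=; rewrite !invm).
- abstract (by move=> x y f /=; rewrite !minv).
Defined.

Definition pair_functor (X C D : groupoid) (F : functor X C)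
  (G : functor X D) : functor X (prod_groupoid C D).
Proof.
refine (@Functor X (prod_groupoid C D) (fun x => (F x, G x))
  (fun x y f => (fhom F f, fhom G f)) _ _).
- abstract (by move=> x /=; rewrite !fhom1).
- abstract (by move=> x y z g f /=; rewrite !fhomM).
Defined.

Definition prod_functor (C C' D D' : groupoid) (F : functor C C')
  (G : functor D D') : functor (prod_groupoid C D) (prod_groupoid C' D').
Proof.
refine (@Functor (prod_groupoid C D) (prod_groupoid C' D')
  (fun x => (F x.1, G x.2)) (fun x y f => (fhom F f.1, fhom G f.2)) _ _).
- abstract (by move=> x /=; rewrite !fhom1).
- abstract (by move=> x y z g f /=; rewrite !fhomM).
Defined.

(** * Homotopy sums and homotopy fibres *)

Record family (B : groupoid) : Type := Family {
  fam :> B -> groupoid;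
  act : forall b b', hom b b' -> functor (fam b) (fam b');
  act1 : forall b, act (idm b) = id_functor (fam b);
  actM : forall b b' b'' (g : hom b' b'') (f : hom b b'),
    act (comp g f) = act g ∘ act f }.

Arguments act {B} _ {b b'} _.

Definition pi0 (B : groupoid) : Type :=
  {P : B -> Prop | exists b, P = fun x => inhabited (hom b x)}.

Definition pi0_repr (B : groupoid) (c : pi0 B) : B :=
  projT1 (cid (proj2_sig c)).

(* The homotopy quotient E_b/Aut(b) is the action groupoid: an arrow from x to
   y is a pair of g in Aut(b) and an arrow from g.x to y. *)
Definition hquot_hom (B : groupoid) (E : family B) (b : B) (x y : E b) :=
  {g : hom b b & hom (act E g x) y}.

Section HomotopyQuotient.
Variables (B : groupoid) (E : family B) (b : B).

Lemma act1_ob (x : E b) : act E (idm b) x = x.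
Proof. by rewrite act1. Qed.

Lemma actM_ob (g f : hom b b) (x : E b) :
  act E (comp g f) x = act E g (act E f x).
Proof. by rewrite actM. Qed.

Lemma actV_ob (g : hom b b) (x : E b) : act E (inv g) (act E g x) = x.
Proof. by rewrite -actM_ob invm act1_ob. Qed.

Definition hquot_id (x : E b) : hquot_hom x x :=
  existT _ (idm b) (hom_of_eq (act1_ob x)).

Definition hquot_comp (x y z : E b) (v : hquot_hom y z) (u : hquot_hom x y) :
    hquot_hom x z :=
  existT _ (comp (projT1 v) (projT1 u))
    (comp (projT2 v)
       (comp (fhom (act E (projT1 v)) (projT2 u))
          (hom_of_eq (actM_ob (projT1 v) (projT1 u) x)))).

Definition hquot_inv (x y : E b) (u : hquot_hom x y) : hquot_hom y x :=
  existT _ (inv (projT1 u))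
    (comp (hom_of_eq (actV_ob (projT1 u) x))
       (fhom (act E (inv (projT1 u))) (inv (projT2 u)))).

Lemma hquot_hom_eq (x y : E b) (u v : hquot_hom x y)
    (e : projT1 u = projT1 v) :
  projT2 u =
    comp (projT2 v) (hom_of_eq (f_equal (fun g => act E g x) e)) -> u = v.
Proof.
case: u v e => [g u] [h v] /= e; case: _ / e v => v /= ->.
by rewrite compm1.
Qed.

Lemma hquot_comp1m (x y : E b) (u : hquot_hom x y) :
  hquot_comp (hquot_id y) u = u.
Proof.
apply: (@hquot_hom_eq _ _ (hquot_comp (hquot_id y) u) u
  (comp1m (projT1 u))) => /=.
rewrite compA (functor_eq_nat (act1 E b) _ (act1_ob _)) -compA comp_hom_of_eq.
by congr (comp _ (hom_of_eq _)); apply: Prop_irrelevance.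
Qed.

Lemma hquot_compm1 (x y : E b) (u : hquot_hom x y) :
  hquot_comp u (hquot_id x) = u.
Proof.
apply: (@hquot_hom_eq _ _ (hquot_comp u (hquot_id x)) u
  (compm1 (projT1 u))) => /=.
rewrite map_hom_of_eq comp_hom_of_eq.
by congr (comp _ (hom_of_eq _)); apply: Prop_irrelevance.
Qed.

Lemma hquot_compA (x y z t : E b) (w : hquot_hom z t) (v : hquot_hom y z)
    (u : hquot_hom x y) :
  hquot_comp w (hquot_comp v u) = hquot_comp (hquot_comp w v) u.
Proof.
apply: (@hquot_hom_eq _ _ (hquot_comp w (hquot_comp v u)) (hquot_comp (hquot_comp w v) u)
  (compA (projT1 w) (projT1 v) (projT1 u))) => /=.
rewrite !fhomM map_hom_of_eq -!compA; congr (comp _ (comp _ _)).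
rewrite !comp_hom_of_eq [RHS]compA.
rewrite (functor_eq_nat (actM E (projT1 w) (projT1 v)) _ (actM_ob _ _ _)) /=.
rewrite -compA comp_hom_of_eq.
by congr (comp _ (hom_of_eq _)); apply: Prop_irrelevance.
Qed.

Lemma hquot_invm (x y : E b) (u : hquot_hom x y) :
  hquot_comp (hquot_inv u) u = hquot_id x.
Proof.
apply: (@hquot_hom_eq _ _ (hquot_comp (hquot_inv u) u) (hquot_id x)
  (invm (projT1 u))) => /=.
rewrite -compA (compA (fhom _ _) (fhom _ _)) -fhomM (invm (projT2 u)) fhom1 comp1m !comp_hom_of_eq.
by congr hom_of_eq; apply: Prop_irrelevance.
Qed.

Lemma hquot_minv (x y : E b) (u : hquot_hom x y) :
  hquot_comp u (hquot_inv u) = hquot_id y.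
Proof.
apply: (@hquot_hom_eq _ _ (hquot_comp u (hquot_inv u)) (hquot_id y)
  (minv (projT1 u))); case: u => g u /=.
have eE : act E g ∘ act E (inv g) = id_functor (E b).
  by rewrite -actM minv act1.
have eob z : act E g (act E (inv g) z) = z.
  by have := f_equal (fun F : functor (E b) (E b) => F z) eE.
rewrite fhomM map_hom_of_eq.
set e1 := f_equal _ _.
have -> : hom_of_eq e1 = hom_of_eq (eob (act E g x)).
  by congr hom_of_eq; apply: Prop_irrelevance.
rewrite -[fhom (act E g) _]/(fhom (act E g ∘ act E (inv g)) (inv u)).
rewrite (functor_eq_nat eE (inv u) (eob _)) /= !compA (minv u) comp1m.
rewrite !comp_hom_of_eq.
by congr hom_of_eq; apply: Prop_irrelevance.
Qed.

Definition hquot : groupoid :=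
  @Groupoid (E b) (@hquot_hom B E b) hquot_id hquot_comp hquot_inv
    hquot_comp1m hquot_compm1 hquot_compA hquot_invm hquot_minv.

End HomotopyQuotient.

Section Coproduct.
Variables (K : Type) (G : K -> groupoid).

Definition coprod_hom (p q : {k : K & G k}) : Type :=
  {e : projT1 p = projT1 q
     & hom (eq_rect _ (fun k => ob (G k)) (projT2 p) _ e) (projT2 q)}.

Definition coprod_id (p : {k : K & G k}) : coprod_hom p p :=
  existT _ erefl (idm (projT2 p)).

Definition coprod_comp (p q r : {k : K & G k}) :
  coprod_hom q r -> coprod_hom p q -> coprod_hom p r.
Proof.
case: p q r => [k x] [k' y] [k'' z] [/= e' g] [/= e f].
case: _ / e' z g => z g; case: _ / e y f z g => y f z g.
exact: (existT _ erefl (comp g f)).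
Defined.

Definition coprod_inv (p q : {k : K & G k}) :
  coprod_hom p q -> coprod_hom q p.
Proof.
case: p q => [k x] [k' y] [/= e f]; case: _ / e y f => y f.
exact: (existT _ erefl (inv f)).
Defined.

Lemma coprod_comp1m p q (f : coprod_hom p q) :
  coprod_comp (coprod_id q) f = f.
Proof.
case: p q f => [k x] [k' y] [/= e f]; case: _ / e y f => y f.
by rewrite /coprod_comp /= comp1m.
Qed.

Lemma coprod_compm1 p q (f : coprod_hom p q) :
  coprod_comp f (coprod_id p) = f.
Proof.
case: p q f => [k x] [k' y] [/= e f]; case: _ / e y f => y f.
by rewrite /coprod_comp /= compm1.
Qed.

Lemma coprod_compA p q r t (h : coprod_hom r t) (g : coprod_hom q r)
    (f : coprod_hom p q) :
  coprod_comp h (coprod_comp g f) = coprod_comp (coprod_comp h g) f.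
Proof.
case: p q r t h g f => [k x] [k' y] [k'' z] [k3 t] [/= e3 h] [/= e' g] [/= e f].
case: _ / e3 t h => t h; case: _ / e' z g t h => z g t h.
case: _ / e y f z g t h => y f z g t h.
by rewrite /coprod_comp /= compA.
Qed.

Lemma coprod_invm p q (f : coprod_hom p q) :
  coprod_comp (coprod_inv f) f = coprod_id p.
Proof.
case: p q f => [k x] [k' y] [/= e f]; case: _ / e y f => y f.
by rewrite /coprod_comp /= invm.
Qed.

Lemma coprod_minv p q (f : coprod_hom p q) :
  coprod_comp f (coprod_inv f) = coprod_id q.
Proof.
case: p q f => [k x] [k' y] [/= e f]; case: _ / e y f => y f.
by rewrite /coprod_comp /= minv.
Qed.

Definition coprod : groupoid :=
  @Groupoid {k : K & G k} coprod_hom coprod_id coprod_comp coprod_inv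
    coprod_comp1m coprod_compm1 coprod_compA coprod_invm coprod_minv.

End Coproduct.

Definition hsum (B : groupoid) (E : family B) : groupoid :=
  coprod (fun c : pi0 B => hquot E (pi0_repr c)).

Section HomotopyFibre.
Variables (X B : groupoid) (f : functor X B).

Definition hfibre_hom (b : B) (u v : {x : X & hom (f x) b}) : Type :=
  {a : hom (projT1 u) (projT1 v) | comp (projT2 v) (fhom f a) = projT2 u}.

Lemma hfibre_hom_eq b (u v : {x : X & hom (f x) b}) (a a' : hfibre_hom u v) :
  sval a = sval a' -> a = a'.
Proof.
case: a a' => [a p] [a' q] /= e; case: _ / e q => q.
by rewrite (Prop_irrelevance p q).
Qed.

Lemma hfibre_id_subproof b (u : {x : X & hom (f x) b}) :
  comp (projT2 u) (fhom f (idm (projT1 u))) = projT2 u.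
Proof. by rewrite fhom1 compm1. Qed.

Lemma hfibre_comp_subproof b (u v w : {x : X & hom (f x) b})
    (a' : hfibre_hom v w) (a : hfibre_hom u v) :
  comp (projT2 w) (fhom f (comp (sval a') (sval a))) = projT2 u.
Proof. by rewrite fhomM compA (svalP a') (svalP a). Qed.

Lemma hfibre_inv_subproof b (u v : {x : X & hom (f x) b})
    (a : hfibre_hom u v) :
  comp (projT2 u) (fhom f (inv (sval a))) = projT2 v.
Proof. by case: a => a /= <-; rewrite -compA -fhomM minv fhom1 compm1. Qed.

Definition hfibre (b : B) : groupoid.
Proof.
refine (@Groupoid {x : X & hom (f x) b} (@hfibre_hom b)
  (fun u => exist _ (idm (projT1 u)) (hfibre_id_subproof u))
  (fun u v w a' a =>
     exist _ (comp (sval a') (sval a)) (hfibre_comp_subproof a' a))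
  (fun u v a => exist _ (inv (sval a)) (hfibre_inv_subproof a)) _ _ _ _ _).
- abstract (by move=> x y a; apply: hfibre_hom_eq; rewrite /= comp1m).
- abstract (by move=> x y a; apply: hfibre_hom_eq; rewrite /= compm1).
- abstract (by move=> *; apply: hfibre_hom_eq; rewrite /= compA).
- abstract (by move=> x y a; apply: hfibre_hom_eq; rewrite /= invm).
- abstract (by move=> x y a; apply: hfibre_hom_eq; rewrite /= minv).
Defined.

End HomotopyFibre.

Section HomotopyFibreFamily.
Variables (X B : groupoid) (f : functor X B).

Definition hfibre_proj b : functor (hfibre f b) X :=
  @Functor (hfibre f b) X (@projT1 _ _) (fun u v a => sval a)
    (fun u => erefl) (fun u v w a' a => erefl).

Lemma hfibre_functor_eq b (C : groupoid) (F G : functor C (hfibre f b)) :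
  (forall x, F x = G x) -> hfibre_proj b ∘ F = hfibre_proj b ∘ G -> F = G.
Proof.
move=> e ep; apply: (functor_eq (e := e)) => x y a; apply: hfibre_hom_eq.
change (fhom (hfibre_proj b) (comp (hom_of_eq (e y)) (fhom F a)) =
  fhom (hfibre_proj b) (comp (fhom G a) (hom_of_eq (e x)))).
by rewrite !fhomM !map_hom_of_eq; apply: (functor_eq_nat ep a).
Qed.

Lemma hfibre_act_subproof (b b' : B) (beta : hom b b') (u v : hfibre f b)
    (a : hom u v) :
  comp (comp beta (projT2 v)) (fhom f (sval a)) = comp beta (projT2 u).
Proof. by case: a => a /= <-; rewrite compA. Qed.

Definition hfibre_act (b b' : B) (beta : hom b b') :
  functor (hfibre f b) (hfibre f b').
Proof.
refine (@Functor (hfibre f b) (hfibre f b')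
  (fun u => existT _ (projT1 u) (comp beta (projT2 u)))
  (fun u v a => exist _ (sval a) (hfibre_act_subproof beta a)) _ _).
- abstract (by move=> u; apply: hfibre_hom_eq).
- abstract (by move=> u v w a' a; apply: hfibre_hom_eq).
Defined.

Lemma hfibre_act1 b : hfibre_act (idm b) = id_functor (hfibre f b).
Proof.
apply: hfibre_functor_eq; first by case=> x g /=; rewrite comp1m.
unshelve eapply functor_eq; first by [].
by move=> u v a; rewrite /= comp1m compm1.
Qed.

Lemma hfibre_actM b b' b'' (g : hom b' b'') (h : hom b b') :
  hfibre_act (comp g h) = hfibre_act g ∘ hfibre_act h.
Proof.
apply: hfibre_functor_eq; first by case=> x k /=; rewrite compA.
unshelve eapply functor_eq; first by [].
by move=> u v a; rewrite /= comp1m compm1.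
Qed.

Definition hfibre_family : family B :=
  @Family B (hfibre f) hfibre_act hfibre_act1 hfibre_actM.

End HomotopyFibreFamily.

Section ProductFamily.
Variables (B : groupoid) (E F : family B).

Lemma prod_act1 b :
  prod_functor (act E (idm b)) (act F (idm b)) =
  id_functor (prod_groupoid (E b) (F b)).
Proof.
rewrite !act1.
have e (u : prod_groupoid (E b) (F b)) :
    prod_functor (id_functor (E b)) (id_functor (F b)) u = id_functor _ u.
  by case: u.
apply: (functor_eq (e := e)) => -[x x'] [y y'] [g g'].
by rewrite !hom_of_eq1 comp1m compm1.
Qed.

Lemma prod_actM b b' b'' (g : hom b' b'') (h : hom b b') :
  prod_functor (act E (comp g h)) (act F (comp g h)) =
  prod_functor (act E g) (act F g) ∘ prod_functor (act E h) (act F h).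
Proof.
rewrite !actM.
have e u : prod_functor (act E g ∘ act E h) (act F g ∘ act F h) u =
    (prod_functor (act E g) (act F g) ∘ prod_functor (act E h) (act F h)) u.
  by [].
apply: (functor_eq (e := e)) => u v a.
by rewrite !hom_of_eq1 comp1m compm1.
Qed.

Definition prod_family : family B :=
  @Family B (fun b => prod_groupoid (E b) (F b))
    (fun b b' g => prod_functor (act E g) (act F g)) prod_act1 prod_actM.

End ProductFamily.

Section SumOfFibreProducts.
Variables (X Y B : groupoid) (f : functor X B) (g : functor Y B).

(* the sum over b in B of the products of the homotopy fibres of f and g *)
Definition fibre_product_family : family B :=
  prod_family (hfibre_family f) (hfibre_family g).

Definition fibre_sum : groupoid := hsum fibre_product_family.

Definition fibre_product_proj b :
    functor (fibre_product_family b) (prod_groupoid X Y) :=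
  prod_functor (hfibre_proj f b) (hfibre_proj g b).

(* The action of Aut(b) on a homotopy fibre does not change the underlying
   point, hence an arrow of the homotopy quotient has an underlying arrow. *)
Definition hquot_proj_hom (b : B) (x y : fibre_product_family b)
    (u : hquot_hom x y) :
    hom (fibre_product_proj b x) (fibre_product_proj b y) :=
  (sval (projT2 u).1, sval (projT2 u).2).

Lemma hom_of_eq_proj1 (b : B) (x y : fibre_product_family b) (e : x = y)
    (e' : projT1 x.1 = projT1 y.1) :
  sval (hom_of_eq e).1 = hom_of_eq e'.
Proof. by case: _ / e e' => e'; rewrite (Prop_irrelevance e' erefl). Qed.

Lemma hom_of_eq_proj2 (b : B) (x y : fibre_product_family b) (e : x = y)
    (e' : projT1 x.2 = projT1 y.2) :
  sval (hom_of_eq e).2 = hom_of_eq e'.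
Proof. by case: _ / e e' => e'; rewrite (Prop_irrelevance e' erefl). Qed.

Lemma hquot_proj1 (b : B) (x : fibre_product_family b) :
  hquot_proj_hom (hquot_id x) = idm (fibre_product_proj b x).
Proof.
exact: (f_equal2 pair (hom_of_eq_proj1 (act1_ob x) erefl)
  (hom_of_eq_proj2 (act1_ob x) erefl)).
Qed.

Lemma hquot_projM (b : B) (x y z : fibre_product_family b)
    (v : hquot_hom y z) (u : hquot_hom x y) :
  hquot_proj_hom (hquot_comp v u) =
  comp (hquot_proj_hom v) (hquot_proj_hom u).
Proof.
case: u v => [k u] [l v].
have := hom_of_eq_proj1 (actM_ob l k x) erefl.
have := hom_of_eq_proj2 (actM_ob l k x) erefl.
rewrite /hquot_proj_hom /hquot_comp.
move: (hom_of_eq (actM_ob l k x)) => /= h e2 e1.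
congr pair.
  rewrite e1.
  by rewrite compm1.
by rewrite e2 compm1.
Qed.

Definition fibre_sum_hom (u v : fibre_sum) : hom u v ->
  hom (fibre_product_proj _ (projT2 u)) (fibre_product_proj _ (projT2 v)).
Proof.
case: u v => [c x] [c' y] [/= e]; case: _ / e y => y.
exact: hquot_proj_hom.
Defined.

Lemma fibre_sum_homM (u v w : fibre_sum) (b : hom v w) (a : hom u v) :
  fibre_sum_hom (comp b a) = comp (fibre_sum_hom b) (fibre_sum_hom a).
Proof.
case: u v w b a => [c x] [c' y] [c'' z] [/= e' b] [/= e a].
case: _ / e' z b => z b; case: _ / e y a z b => y a z b.
exact: hquot_projM.
Qed.

Lemma fibre_sum_hom1 (u : fibre_sum) :
  fibre_sum_hom (idm u) = idm (fibre_product_proj _ (projT2 u)).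
Proof. case: u => [c x]; exact: hquot_proj1. Qed.

Definition fibre_sum_proj : functor fibre_sum (prod_groupoid X Y) :=
  @Functor fibre_sum (prod_groupoid X Y)
    (fun u => fibre_product_proj _ (projT2 u)) fibre_sum_hom
    fibre_sum_hom1 fibre_sum_homM.

(* The point (w, (x, gamma : f x -> w), (y, delta : g y -> w)) of the sum lies
   over (x, y) and determines the arrow delta^-1 gamma : f x -> g y. *)
Definition fibre_sum_cell (u : fibre_sum) :
    hom (f (fibre_sum_proj u).1) (g (fibre_sum_proj u).2) :=
  comp (inv (projT2 (projT2 u).2)) (projT2 (projT2 u).1).

End SumOfFibreProducts.

(** * Polynomial functors *)

(* [over I] is the strict slice Grpd/I over a set [I]: a functor into
   [discrete I] is a function on objects that is constant along arrows. *)
Record over (I : Type) : Type := Over {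
  total :> groupoid;
  colour : total -> I;
  colour_hom : forall x y : total, hom x y -> colour x = colour y }.

Arguments colour {I} _ _.

Record over_map (I : Type) (X Y : over I) : Type := OverMap {
  over_fun :> functor X Y;
  over_funE : forall x, colour Y (over_fun x) = colour X x }.

Lemma comp_over_map_subproof (I : Type) (X Y Z : over I) (G : over_map Y Z)
  (F : over_map X Y) x : colour Z ((G ∘ F) x) = colour X x.
Proof. by rewrite /= !over_funE. Qed.

Definition comp_over_map (I : Type) (X Y Z : over I) (G : over_map Y Z)
    (F : over_map X Y) : over_map X Z :=
  OverMap (comp_over_map_subproof G F).

(* A polynomial I <-s- E -p-> B -t-> J of groupoids, I and J being sets and p a
   discrete fibration. The groupoid E over B is encoded by its fibres and the
   action of the arrows of B on them: the objects of E are the pairs of b in B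
   and e in [fibre b], and its arrows (b,e) -> (b',e') are the arrows
   beta : b -> b' such that [slot beta e = e']. *)
Record polynomial (I J : Type) : Type := Polynomial {
  base :> groupoid;
  fibre : base -> Type;
  slot : forall b b' : base, hom b b' -> fibre b -> fibre b';
  slot1 : forall b e, slot (idm b) e = e;
  slotM : forall (b b' b'' : base) (g : hom b' b'') (f : hom b b') e,
    slot (comp g f) e = slot g (slot f e);
  src : forall b : base, fibre b -> I;
  src_slot : forall (b b' : base) (f : hom b b') e, src (slot f e) = src e;
  tgt : base -> J;
  tgt_hom : forall b b' : base, hom b b' -> tgt b = tgt b' }.

Arguments slot {I J} _ {b b'} _ _.
Arguments src {I J} _ {b} _.

(* The value t_! p_* s^* X. Its objects are the pairs of b in B and a section
   over the fibre E_b of s^* X -> E; an arrow over beta : b -> b' consists of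
   an arrow of s^* X over every arrow of E over beta. *)
Section Extension.
Variables (I J : Type) (P : polynomial I J).

Record ext_ob (X : over I) : Type := ExtOb {
  ext_base : P;
  ext_sec : fibre ext_base -> X;
  ext_src : forall e, colour X (ext_sec e) = src P e }.

Arguments ext_sec {X} _ _.

Definition ext_hom (X : over I) (r r' : ext_ob X) : Type :=
  {beta : hom (ext_base r) (ext_base r') &
   forall e e', slot P beta e = e' -> hom (ext_sec r e) (ext_sec r' e')}.

Section ExtensionGroupoid.
Variable X : over I.

Lemma ext_hom_eq (r r' : ext_ob X) (u v : ext_hom r r') :
  projT1 u = projT1 v ->
  (forall e e' h h', projT2 u e e' h = projT2 v e e' h') -> u = v.
Proof.
case: u v => [a u] [b v] /= eab; case: _ / eab v => v euv.
congr existT; apply: functional_extensionality_dep => e.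
apply: functional_extensionality_dep => e'.
by apply: functional_extensionality_dep => h; apply: euv.
Qed.

Lemma slot_idE (b : P) (e e' : fibre b) : slot P (idm b) e = e' -> e = e'.
Proof. by rewrite slot1. Qed.

Lemma slot_compE (b b' b'' : P) (g : hom b' b'') (f : hom b b')
    (e : fibre b) (e'' : fibre b'') :
  slot P (comp g f) e = e'' -> slot P g (slot P f e) = e''.
Proof. by rewrite slotM. Qed.

Lemma slot_invE (b b' : P) (f : hom b b') (e : fibre b) (e' : fibre b') :
  slot P (inv f) e' = e -> slot P f e = e'.
Proof. by move=> <-; rewrite -slotM minv slot1. Qed.

Definition ext_id (r : ext_ob X) : ext_hom r r :=
  existT _ (idm (ext_base r))
    (fun e e' h => hom_of_eq (f_equal (ext_sec r) (slot_idE h))).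

Definition ext_comp (r r' r'' : ext_ob X) (v : ext_hom r' r'')
    (u : ext_hom r r') : ext_hom r r'' :=
  existT _ (comp (projT1 v) (projT1 u))
    (fun e e'' h =>
       comp (projT2 v (slot P (projT1 u) e) e'' (slot_compE h))
            (projT2 u e (slot P (projT1 u) e) erefl)).

Definition ext_inv (r r' : ext_ob X) (u : ext_hom r r') : ext_hom r' r :=
  existT _ (inv (projT1 u))
    (fun e' e h => inv (projT2 u e e' (slot_invE h))).

Lemma ext_comp1m r r' (u : ext_hom r r') : ext_comp (ext_id r') u = u.
Proof.
apply: ext_hom_eq => [|e e' h h'] /=; first by rewrite comp1m.
by case: _ / h' {h} (slot_compE h) => h; rewrite hom_of_eq1 comp1m.
Qed.

Lemma ext_compm1 r r' (u : ext_hom r r') : ext_comp u (ext_id r) = u.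
Proof.
apply: ext_hom_eq => [|e e' h h'] /=; first by rewrite compm1.
move: (slot_compE h) (slot_idE _); rewrite /= slot1 => h1 h2.
by rewrite hom_of_eq1 compm1 (Prop_irrelevance h1 h').
Qed.

Lemma ext_compA r0 r1 r2 r3 (w : ext_hom r2 r3) (v : ext_hom r1 r2)
    (u : ext_hom r0 r1) :
  ext_comp w (ext_comp v u) = ext_comp (ext_comp w v) u.
Proof.
apply: ext_hom_eq => [|e e' h h'] /=; first by rewrite compA.
case: w v u h h' => [w w'] [v v'] [u u'] /= h h'.
move: (slot_compE (erefl (slot P (comp v u) e))) (slot_compE h).
move: (slot P (comp v u) e) => m hm; case: _ / hm => h1.
by rewrite compA (Prop_irrelevance h1 (slot_compE (slot_compE h'))).
Qed.

Lemma ext_invm r r' (u : ext_hom r r') : ext_comp (ext_inv u) u = ext_id r.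
Proof.
case: u => b u; apply: ext_hom_eq => [|e e' h h'] /=; first by rewrite invm.
case: _ / (slot_idE h') h => h; rewrite hom_of_eq1.
by rewrite (Prop_irrelevance (slot_invE _) erefl) invm.
Qed.

Lemma ext_minv r r' (u : ext_hom r r') : ext_comp u (ext_inv u) = ext_id r'.
Proof.
case: u => b u; apply: ext_hom_eq => [|e e' h h'] /=; first by rewrite minv.
case: _ / (slot_idE h') h => h; rewrite hom_of_eq1.
by rewrite (Prop_irrelevance (slot_compE h) (slot_invE erefl)) minv.
Qed.

Definition ext_groupoid : groupoid :=
  @Groupoid (ext_ob X) (@ext_hom X) ext_id ext_comp ext_inv
    ext_comp1m ext_compm1 ext_compA ext_invm ext_minv.

End ExtensionGroupoid.

Definition ext (X : over I) : over J :=
  @Over J (ext_groupoid X) (fun r => tgt (ext_base r))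
    (fun r r' u => tgt_hom (projT1 u)).

Section ExtensionMap.
Variables (X Y : over I) (F : over_map X Y).

Lemma ext_map_src (r : ext X) (e : fibre (ext_base r)) : colour Y (F (ext_sec r e)) = src P e.
Proof. by rewrite over_funE ext_src. Qed.

Definition ext_map_ob (r : ext X) : ext Y := @ExtOb Y (ext_base r) _ (@ext_map_src r).

Definition ext_map_hom (r r' : ext X) (u : hom r r') :
    hom (ext_map_ob r) (ext_map_ob r') :=
  existT _ (projT1 u) (fun e e' h => fhom F (projT2 u e e' h)).

Lemma ext_map_hom1 r : ext_map_hom (idm r) = idm (ext_map_ob r).
Proof.
apply: ext_hom_eq => [//|e e' h h'] /=.
by case: _ / (slot_idE h') (slot_idE h) => h1; rewrite !hom_of_eq1 fhom1.
Qed.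

Lemma ext_map_homM r r' r'' (v : hom r' r'') (u : hom r r') :
  ext_map_hom (comp v u) = comp (ext_map_hom v) (ext_map_hom u).
Proof.
apply: ext_hom_eq => [//|e e' h h'] /=.
by rewrite (Prop_irrelevance h h') fhomM.
Qed.

Definition ext_map : over_map (ext X) (ext Y) :=
  @OverMap J (ext X) (ext Y) (Functor ext_map_hom1 ext_map_homM)
    (fun r => erefl).

End ExtensionMap.

End Extension.

Arguments ext_sec {I J P X} _ _.
Arguments ext_src {I J P X} _ _.

Lemma ext_comp_homE (I J : Type) (P : polynomial I J) (X : over I)
    (r r' r'' : ext_ob P X) (v : ext_hom r' r'') (u : ext_hom r r') a a' a''
    (hu : slot P (projT1 u) a = a') (hv : slot P (projT1 v) a' = a'') h :
  projT2 (ext_comp v u) a a'' h = comp (projT2 v a' a'' hv) (projT2 u a a' hu).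
Proof.
by case: _ / hu hv => hv /=; rewrite (Prop_irrelevance hv (slot_compE h)).
Qed.

Lemma ext_hom_of_eq_sec (I J : Type) (P : polynomial I J) (X : over I)
    (r : ext P X) (e : r = r) a (h : slot P (projT1 (hom_of_eq e)) a = a) :
  projT2 (hom_of_eq e) a a h = idm (ext_sec r a).
Proof.
by move: h; rewrite (Prop_irrelevance e erefl) /= => h; rewrite hom_of_eq1.
Qed.

Lemma ext_comp2_homE (I J K : Type) (P : polynomial J K) (Q : polynomial I J)
    (X : over I) (r r' r'' : ext P (ext Q X)) (v : hom r' r'') (u : hom r r')
    a a' a'' (hu : slot P (projT1 u) a = a') (hv : slot P (projT1 v) a' = a'')
    (h : slot P (projT1 (comp v u)) a = a'') b b' b''
    (ku : slot Q (projT1 (projT2 u a a' hu)) b = b')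
    (kv : slot Q (projT1 (projT2 v a' a'' hv)) b' = b'')
    (k : slot Q (projT1 (projT2 (comp v u) a a'' h)) b = b'') :
  projT2 (projT2 (comp v u) a a'' h) b b'' k =
  comp (projT2 (projT2 v a' a'' hv) b' b'' kv)
       (projT2 (projT2 u a a' hu) b b' ku).
Proof.
have e : projT2 (comp v u) a a'' h =
    comp (projT2 v a' a'' hv) (projT2 u a a' hu) by exact: ext_comp_homE.
by move: k; rewrite e => k; apply: ext_comp_homE.
Qed.

Lemma ext_id2_homE (I J K : Type) (P : polynomial J K) (Q : polynomial I J)
    (X : over I) (r : ext P (ext Q X)) a (h : slot P (projT1 (idm r)) a = a)
    b (k : slot Q (projT1 (projT2 (idm r) a a h)) b = b) :
  projT2 (projT2 (idm r) a a h) b b k = idm (ext_sec (ext_sec r a) b).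
Proof. exact: ext_hom_of_eq_sec. Qed.

(** * The symmetric monoidal category monad *)

(* The groupoid of finite sets is taken in its skeletal form: the objects are
   the sets 'I_n, so that [Smon X] consists of finite sequences and concatenation
   of sequences is strictly associative. *)
Record bij (m n : nat) : Type := Bij {
  bij_fun :> 'I_m -> 'I_n;
  bij_inv : 'I_n -> 'I_m;
  bijK : cancel bij_fun bij_inv;
  bijVK : cancel bij_inv bij_fun }.

Lemma bij_eq m n (s t : bij m n) : (forall i, s i = t i) -> s = t.
Proof.
move=> /funext; case: s t => [s s' sK s'K] [t t' tK t'K] /= est.
case: _ / est tK t'K => tK t'K.
have es' : s' = t' by apply: funext => i; rewrite -{1}[i]t'K sK.
case: _ / es' tK t'K => tK t'K.
by rewrite (Prop_irrelevance sK tK) (Prop_irrelevance s'K t'K).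
Qed.

Definition bij1 n : bij n n :=
  @Bij n n id id (fun=> erefl) (fun=> erefl).

Definition bijM m n p (t : bij n p) (s : bij m n) : bij m p :=
  Bij (can_comp (bijK t) (bijK s)) (can_comp (bijVK s) (bijVK t)).

Definition bijV m n (s : bij m n) : bij n m := Bij (bijVK s) (bijK s).

Definition finset_groupoid : groupoid.
Proof.
refine (@Groupoid nat bij bij1 (fun m n p t s => bijM t s) bijV _ _ _ _ _);
  abstract (by move=> *; apply: bij_eq => i //=; rewrite ?bijK ?bijVK).
Defined.

(* 1 <- B' -> B -> 1, the fibre of B' -> B over n being 'I_n *)
Definition sym_polynomial : polynomial unit unit :=
  @Polynomial unit unit finset_groupoid (fun n => 'I_n)
    (fun m n (s : bij m n) i => s i) (fun n i => erefl)
    (fun m n p t s i => erefl) (fun n i => tt) (fun m n s i => erefl)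
    (fun n => tt) (fun m n s => erefl).

Definition over_unit (X : groupoid) : over unit :=
  @Over unit X (fun=> tt) (fun x y f => erefl).

Definition over_unit_map (X Y : groupoid) (F : functor X Y) :
    over_map (over_unit X) (over_unit Y) :=
  @OverMap unit (over_unit X) (over_unit Y) F (fun x => erefl).

Definition Smon (X : groupoid) : groupoid := ext sym_polynomial (over_unit X).

Definition Smon_map (X Y : groupoid) (F : functor X Y) : functor (Smon X) (Smon Y) :=
  ext_map sym_polynomial (over_unit_map F).

Definition Smon_ob (X : groupoid) (n : nat) (x : 'I_n -> X) : Smon X :=
  @ExtOb unit unit sym_polynomial (over_unit X) n x (fun=> erefl).

Definition Smon_unit (X : groupoid) : functor X (Smon X).
Proof.
refine (@Functor X (Smon X) (fun x => @Smon_ob X 1 (fun=> x))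
  (fun x y f => existT _ (bij1 1) (fun e e' h => f)) _ _).
- abstract (by move=> x; apply: ext_hom_eq => [//|e e' h h'] /=;
              rewrite hom_of_eq1).
- abstract (by move=> x y z g f; apply: ext_hom_eq => [|e e' h h'] //=;
              apply: bij_eq).
Defined.

(* 'I_(\sum_i k i) is in lexicographic bijection with {i & 'I_(k i)}, see
   [tagnat]; a bijection s together with bijections of the blocks induces a
   bijection of the sums. *)
Section BlockBijection.
Variables (m n : nat) (k : 'I_m -> nat) (k' : 'I_n -> nat) (s : bij m n).
Variable t : forall i i', s i = i' -> bij (k i) (k' i').

Definition block_fun (p : 'I_(\sum_i k i)) : 'I_(\sum_i k' i) :=
  tagnat.Rank _ (t (erefl (s (tagnat.sig1 p))) (tagnat.sig2 p)).

Definition block_inv (p : 'I_(\sum_i k' i)) : 'I_(\sum_i k i) :=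
  tagnat.Rank _ (bij_inv (t (bijVK s (tagnat.sig1 p))) (tagnat.sig2 p)).

Lemma Rank_inj_eq (a : nat) (h : 'I_a -> nat) (i i' : 'I_a) (j : 'I_(h i))
    (j' : 'I_(h i')) :
  tagnat.Rank _ j = tagnat.Rank _ j' -> Tagged (fun i => 'I_(h i)) j = Tagged _ j'.
Proof. exact: tagnat.rank_inj. Qed.

Lemma Rank_elim (a : nat) (h : 'I_a -> nat) (Q : 'I_(\sum_i h i) -> Prop) :
  (forall i (j : 'I_(h i)), Q (tagnat.Rank _ j)) -> forall p, Q p.
Proof. by move=> hQ p; rewrite -(tagnat.sig2K p). Qed.

Lemma block_funE i i' (h : s i = i') (j : 'I_(k i)) :
  block_fun (tagnat.Rank _ j) = tagnat.Rank _ (t h j).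
Proof.
rewrite /block_fun /tagnat.sig1 /tagnat.sig2 [tagnat.sig _]tagnat.rankK /=.
by case: _ / h.
Qed.

Lemma block_invE i i' (h : s i = i') (j' : 'I_(k' i')) :
  block_inv (tagnat.Rank _ j') = tagnat.Rank _ (bij_inv (t h) j').
Proof.
rewrite /block_inv /tagnat.sig1 /tagnat.sig2 [tagnat.sig _]tagnat.rankK /=.
move: (bijVK s i') => h'; have ei : bij_inv s i' = i by rewrite -h bijK.
by case: _ / (esym ei) h' => h'; rewrite (Prop_irrelevance h' h).
Qed.

Lemma block_funK : cancel block_fun block_inv.
Proof.
by apply: Rank_elim => i j; rewrite (block_funE erefl) (block_invE erefl) bijK.
Qed.

Lemma block_invK : cancel block_inv block_fun.
Proof.
apply: Rank_elim => i j.
by rewrite (block_invE (bijVK s i)) (block_funE (bijVK s i)) bijVK.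
Qed.

Definition block_bij : bij (\sum_i k i) (\sum_i k' i) :=
  Bij block_funK block_invK.

Lemma block_fun_eq1 p q : block_fun p = q -> s (tagnat.sig1 p) = tagnat.sig1 q.
Proof. by move=> <-; rewrite /block_fun tagnat.Rank1K. Qed.

Lemma block_fun_eq2 p q (h : block_fun p = q) :
  t (block_fun_eq1 h) (tagnat.sig2 p) = tagnat.sig2 q.
Proof.
move: (block_fun_eq1 h) => h1.
have : tagnat.Rank _ (t h1 (tagnat.sig2 p)) = tagnat.Rank _ (tagnat.sig2 q).
  by rewrite -block_funE !tagnat.sig2K.
by move/Rank_inj_eq/eqP; rewrite eq_Tagged => /eqP.
Qed.

End BlockBijection.

(* concatenation *)
Section Concatenation.
Variable X : groupoid.

Definition Smon_mult_ob (r : Smon (Smon X)) : Smon X :=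
  @Smon_ob X (\sum_i ext_base (ext_sec r i))
    (fun p => ext_sec (ext_sec r (tagnat.sig1 p)) (tagnat.sig2 p)).

Definition Smon_mult_hom (r r' : Smon (Smon X)) (u : hom r r') :
    hom (Smon_mult_ob r) (Smon_mult_ob r') :=
  existT _ (block_bij (fun i i' h => projT1 (projT2 u i i' h)))
    (fun p q h => projT2 (projT2 u _ _ (block_fun_eq1 h)) _ _
       (block_fun_eq2 h)).

Lemma Smon_mult_hom1 (r : Smon (Smon X)) :
  Smon_mult_hom (idm r) = idm (Smon_mult_ob r).
Proof.
apply: ext_hom_eq => [|e e' h h'].
  apply: bij_eq; apply: Rank_elim => i j.
  by rewrite /= (block_funE _ erefl) /= hom_of_eq1.
have ee' : e = e' := slot_idE h'.
case: _ / ee' h h' => h h'; apply: (etrans _ (esym (hom_of_eq1 _))).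
exact: (@ext_id2_homE _ _ _ sym_polynomial sym_polynomial (over_unit X) r
  _ _ _ (block_fun_eq2 h)).
Qed.

Lemma Smon_mult_homM (r r' r'' : Smon (Smon X)) (v : hom r' r'')
    (u : hom r r') :
  Smon_mult_hom (comp v u) = comp (Smon_mult_hom v) (Smon_mult_hom u).
Proof.
apply: ext_hom_eq => [|e e' h h'].
  apply: bij_eq; apply: Rank_elim => i j.
  rewrite /= !(block_funE _ erefl) /=.
  by rewrite (Prop_irrelevance (slot_compE _) erefl).
set m := slot sym_polynomial (projT1 (Smon_mult_hom u)) e.
have hu : slot sym_polynomial (projT1 (Smon_mult_hom u)) e = m by [].
rewrite (ext_comp_homE hu (slot_compE h')).
exact: ext_comp2_homE.
Qed.

Definition Smon_mult : functor (Smon (Smon X)) (Smon X) :=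
  Functor Smon_mult_hom1 Smon_mult_homM.

End Concatenation.

(** * Operads *)

(* Coloured symmetric operads in sets. [op n] is the set of n-ary operations,
   [op_in o i] is the colour of the i-th input of [o] and [op_out o] its output
   colour; [op_act] is the action of the symmetric groups ([bij m n] is empty
   unless m = n). The slots of the substitution [op_comp o q] are ordered
   lexicographically: [tagnat.Rank i j] is the j-th slot of [q i]. Operations
   whose arities are only propositionally equal are compared in the set
   {n & op n} of all operations. *)
Record operad : Type := Operad {
  op_colour : Type;
  op : nat -> Type;
  op_in : forall n, op n -> 'I_n -> op_colour;
  op_out : forall n, op n -> op_colour;
  op_act : forall m n, bij m n -> op m -> op n;
  op_unit : op_colour -> op 1;
  op_comp : forall n (o : op n) (k : 'I_n -> nat) (q : forall i, op (k i)),
    (forall i, op_out (q i) = op_in o i) -> op (\sum_i k i);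
  op_act1 : forall n (o : op n), op_act (bij1 n) o = o;
  op_actM : forall m n p (t : bij n p) (s : bij m n) (o : op m),
    op_act (bijM t s) o = op_act t (op_act s o);
  op_in_act : forall m n (s : bij m n) (o : op m) i,
    op_in (op_act s o) (s i) = op_in o i;
  op_out_act : forall m n (s : bij m n) (o : op m),
    op_out (op_act s o) = op_out o;
  op_in_unit : forall c i, op_in (op_unit c) i = c;
  op_out_unit : forall c, op_out (op_unit c) = c;
  op_in_comp : forall n (o : op n) k (q : forall i, op (k i)) h i j,
    op_in (@op_comp n o k q h) (tagnat.Rank i j) = op_in (q i) j;
  op_out_comp : forall n (o : op n) k (q : forall i, op (k i)) h,
    op_out (@op_comp n o k q h) = op_out o;
  op_comp_act : forall m n (s : bij m n) (o : op m)
      (k : 'I_m -> nat) (k' : 'I_n -> nat)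
      (t : forall i i', s i = i' -> bij (k i) (k' i'))
      (q : forall i, op (k i)) (q' : forall i, op (k' i)) h h',
    (forall i i' (e : s i = i'), op_act (t i i' e) (q i) = q' i') ->
    @op_comp n (op_act s o) k' q' h' =
    op_act (block_bij t) (@op_comp m o k q h);
  op_comp1m : forall n (o : op n) c h,
    Tagged op (@op_comp 1 (op_unit c) (fun=> n) (fun=> o) h) = Tagged op o;
  op_compm1 : forall n (o : op n) h,
    Tagged op (@op_comp n o (fun=> 1) (fun i => op_unit (op_in o i)) h)
    = Tagged op o;
  op_compA : forall n (o : op n) k (q : forall i, op (k i)) h
      (l : 'I_(\sum_i k i) -> nat) (r : forall p, op (l p)) h1 h2 h3,
    Tagged op (@op_comp _ (@op_comp n o k q h) l r h1) =
    Tagged op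
      (@op_comp n o (fun i => \sum_j l (tagnat.Rank i j))
        (fun i => @op_comp _ (q i) (fun j => l (tagnat.Rank i j))
           (fun j => r (tagnat.Rank i j)) (h2 i)) h3) }.

Arguments op_in {o n} _ _ : rename.
Arguments op_out {o n} _ : rename.
Arguments op_act {o m n} _ _ : rename.
Arguments op_unit {o} _ : rename.
Arguments op_comp {o n} _ {k} _ _ : rename.

(* The groupoid B: the disjoint union over n of the action groupoids of the
   symmetric groups on the sets of n-ary operations. *)
Section OperationGroupoid.
Variable R : operad.

Definition op_hom (a b : {n & op R n}) : Type :=
  {s : bij (projT1 a) (projT1 b) | op_act s (projT2 a) = projT2 b}.

Lemma op_hom_eq (a b : {n & op R n}) (s t : op_hom a b) :
  (forall i, sval s i = sval t i) -> s = t.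
Proof.
case: s t => [s hs] [t ht] /= /bij_eq e; case: _ / e ht => ht.
by rewrite (Prop_irrelevance hs ht).
Qed.

Lemma op_homM_subproof (a b c : {n & op R n}) (t : op_hom b c)
    (s : op_hom a b) :
  op_act (bijM (sval t) (sval s)) (projT2 a) = projT2 c.
Proof. by rewrite op_actM (svalP s) (svalP t). Qed.

Lemma op_homV_subproof (a b : {n & op R n}) (s : op_hom a b) :
  op_act (bijV (sval s)) (projT2 b) = projT2 a.
Proof.
case: s => s /= <-; rewrite -op_actM -[RHS]op_act1; congr op_act.
by apply: bij_eq => i /=; apply: bijK.
Qed.

Definition op_groupoid : groupoid.
Proof.
refine (@Groupoid {n & op R n} op_hom
  (fun a => exist _ (bij1 _) (op_act1 (projT2 a)))
  (fun a b c t s => exist _ (bijM (sval t) (sval s)) (op_homM_subproof t s))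
  (fun a b s => exist _ (bijV (sval s)) (op_homV_subproof s)) _ _ _ _ _);
  abstract (by move=> *; apply: op_hom_eq => i //=; rewrite ?bijK ?bijVK).
Defined.

Lemma op_src_slot (a b : op_groupoid) (s : hom a b) i :
  op_in (projT2 b) (sval s i) = op_in (projT2 a) i.
Proof. by case: s => s /= <-; rewrite op_in_act. Qed.

Lemma op_tgt_hom (a b : op_groupoid) (s : hom a b) :
  op_out (projT2 a) = op_out (projT2 b).
Proof. by case: s => s /= <-; rewrite op_out_act. Qed.

(* I <- E -> B -> I, where E is the groupoid of operations with a marked input
   slot; it is the pullback of B' -> B along the arity. *)
Definition op_polynomial : polynomial (op_colour R) (op_colour R) :=
  @Polynomial (op_colour R) (op_colour R) op_groupoid
    (fun a => 'I_(projT1 a)) (fun a b s i => sval s i)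
    (fun a i => erefl) (fun a b c t s i => erefl)
    (fun a i => op_in (projT2 a) i) op_src_slot
    (fun a => op_out (projT2 a)) op_tgt_hom.

End OperationGroupoid.

Section OperadMonad.
Variable R : operad.
Local Notation I := (op_colour R).

Definition Rm (X : over I) : over I := ext (op_polynomial R) X.

Definition Rm_map (X Y : over I) (F : over_map X Y) :
  over_map (Rm X) (Rm Y) := ext_map (op_polynomial R) F.

Definition Rm_ob (X : over I) (n : nat) (o : op R n) (x : 'I_n -> X)
    (h : forall i, colour X (x i) = op_in o i) : Rm X :=
  @ExtOb I I (op_polynomial R) X (Tagged (op R) o) x h.

(* phi : F_! R => S F_!, induced by the map of polynomials given by the arity
   on B and by the identity on the slots. *)
Section Phi.
Variable X : over I.

Definition phi_ob (r : Rm X) : Smon X := Smon_ob (ext_sec r).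

Definition phi_hom (r r' : Rm X) (u : hom r r') :
    hom (phi_ob r) (phi_ob r') :=
  existT _ (sval (projT1 u)) (projT2 u).

Lemma phi_hom1 r : phi_hom (idm r) = idm (phi_ob r).
Proof.
apply: ext_hom_eq => [//|e e' h h'] /=.
by congr hom_of_eq; apply: Prop_irrelevance.
Qed.

Lemma phi_homM r r' r'' (v : hom r' r'') (u : hom r r') :
  phi_hom (comp v u) = comp (phi_hom v) (phi_hom u).
Proof.
apply: ext_hom_eq => [//|e e' h h'] /=.
by congr (comp (projT2 v _ _ _) _); apply: Prop_irrelevance.
Qed.

Definition phi : functor (Rm X) (Smon X) := Functor phi_hom1 phi_homM.

End Phi.

Section Unit.
Variable X : over I.

Definition Rm_unit_ob (x : X) : Rm X :=
  @Rm_ob X 1 (op_unit (colour X x)) (fun=> x)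
    (fun i => esym (op_in_unit (colour X x) i)).

Lemma Rm_unit_act (x y : X) (f : hom x y) :
  op_act (bij1 1) (op_unit (colour X x)) = op_unit (colour X y).
Proof. by rewrite op_act1 (colour_hom f). Qed.

Definition Rm_unit_hom (x y : X) (f : hom x y) :
    hom (Rm_unit_ob x) (Rm_unit_ob y) :=
  existT _ (exist _ (bij1 1) (Rm_unit_act f)) (fun e e' h => f).

Lemma Rm_unit_hom1 x : Rm_unit_hom (idm x) = idm (Rm_unit_ob x).
Proof.
apply: ext_hom_eq => [|e e' h h'] /=; first exact: op_hom_eq.
by rewrite hom_of_eq1.
Qed.

Lemma Rm_unit_homM x y z (g : hom y z) (f : hom x y) :
  Rm_unit_hom (comp g f) = comp (Rm_unit_hom g) (Rm_unit_hom f).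
Proof. by apply: ext_hom_eq => //; apply: op_hom_eq. Qed.

Definition Rm_unit : over_map X (Rm X) :=
  @OverMap I X (Rm X) (Functor Rm_unit_hom1 Rm_unit_homM)
    (fun x => op_out_unit _).

End Unit.

Section Multiplication.
Variable X : over I.

Lemma Rm_mult_src (r : Rm (Rm X))
    (p : 'I_(\sum_i projT1 (ext_base (ext_sec r i)))) :
  colour X (ext_sec (ext_sec r (tagnat.sig1 p)) (tagnat.sig2 p)) =
  op_in (op_comp (projT2 (ext_base r))
    (fun i => projT2 (ext_base (ext_sec r i))) (ext_src r)) p.
Proof.
rewrite -[in RHS](tagnat.sig2K p) op_in_comp.
exact: (ext_src (ext_sec r (tagnat.sig1 p))).
Qed.

Definition Rm_mult_ob (r : Rm (Rm X)) : Rm X := Rm_ob (@Rm_mult_src r).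

Lemma Rm_mult_act (r r' : Rm (Rm X)) (u : hom r r') :
  op_act (block_bij (fun i i' h => sval (projT1 (projT2 u i i' h))))
    (projT2 (ext_base (Rm_mult_ob r))) =
  projT2 (ext_base (Rm_mult_ob r')).
Proof.
case: r r' u => [[n o] x hx] [[n' o'] x' hx'] [[/= s hs] u] /=.
case: _ / hs x' hx' u => x' hx' u.
by symmetry; apply: op_comp_act => i i' e; apply: (svalP (projT1 (u i i' e))).
Qed.

Definition Rm_mult_hom (r r' : Rm (Rm X)) (u : hom r r') :
    hom (Rm_mult_ob r) (Rm_mult_ob r') :=
  existT _ (exist _ _ (Rm_mult_act u))
    (fun p q h => projT2 (projT2 u _ _ (block_fun_eq1 h)) _ _
       (block_fun_eq2 h)).

Lemma Rm_mult_hom1 (r : Rm (Rm X)) :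
  Rm_mult_hom (idm r) = idm (Rm_mult_ob r).
Proof.
apply: ext_hom_eq => [|e e' h h'].
  apply: op_hom_eq; apply: Rank_elim => i j.
  by rewrite /= (block_funE _ erefl) /= hom_of_eq1.
have ee' : e = e' := slot_idE h'.
case: _ / ee' h h' => h h'; apply: (etrans _ (esym (hom_of_eq1 _))).
exact: (@ext_id2_homE _ _ _ (op_polynomial R) (op_polynomial R) X r
  _ _ _ (block_fun_eq2 h)).
Qed.

Lemma Rm_mult_homM (r r' r'' : Rm (Rm X)) (v : hom r' r'') (u : hom r r') :
  Rm_mult_hom (comp v u) = comp (Rm_mult_hom v) (Rm_mult_hom u).
Proof.
apply: ext_hom_eq => [|e e' h h'].
  apply: op_hom_eq; apply: Rank_elim => i j.
  rewrite /= !(block_funE _ erefl) /=.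
  by rewrite (Prop_irrelevance (slot_compE _) erefl).
set m := slot (op_polynomial R) (projT1 (Rm_mult_hom u)) e.
have hu : slot (op_polynomial R) (projT1 (Rm_mult_hom u)) e = m by [].
rewrite (ext_comp_homE hu (slot_compE h')).
exact: ext_comp2_homE.
Qed.

Definition Rm_mult : over_map (Rm (Rm X)) (Rm X) :=
  @OverMap I (Rm (Rm X)) (Rm X) (Functor Rm_mult_hom1 Rm_mult_homM)
    (fun r => op_out_comp _).

End Multiplication.
End OperadMonad.

(** * The two-sided bar construction *)

Section Bar.
Variable R : operad.
Local Notation I := (op_colour R).

Definition barA : over I := @Over I (discrete I) id (fun i j e => e).

Lemma discrete_hom_eq (K : Type) (i j : discrete K) (f g : hom i j) : f = g.
Proof. exact: (@Prop_irrelevance (i = j)). Qed.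

Definition alpha_functor : functor (Rm barA) barA :=
  @Functor (Rm barA) barA (colour (Rm barA)) (@colour_hom _ (Rm barA))
    (fun r => discrete_hom_eq _ _) (fun r r' r'' v u => discrete_hom_eq _ _).

Definition alpha : over_map (Rm barA) barA :=
  @OverMap I (Rm barA) barA alpha_functor (fun r => erefl).

Fixpoint Rpow (n : nat) : over I := if n is m.+1 then Rm (Rpow m) else barA.

(* R^(n-k) mu_{R^(k-1) A} for k <= n, where mu_{R^(-1) A} is alpha *)
Fixpoint Rface (n k : nat) : over_map (Rpow n.+1) (Rpow n) :=
  match n return over_map (Rpow n.+1) (Rpow n) with
  | 0 => alpha
  | m.+1 => if k <= m then Rm_map (Rface m k) else Rm_mult (Rpow m)
  end.

(* R^(n-k) eta_{R^k A} for k <= n *)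
Fixpoint Rdegen (n k : nat) : over_map (Rpow n) (Rpow n.+1) :=
  match n return over_map (Rpow n) (Rpow n.+1) with
  | 0 => Rm_unit barA
  | m.+1 => if k <= m then Rm_map (Rdegen m k) else Rm_unit (Rpow m.+1)
  end.

Definition barC (n : nat) : groupoid := Rpow n.
Definition barD (n : nat) : groupoid := Smon (barC n).

Definition C_face (n k : nat) : functor (barC n.+1) (barC n) := Rface n k.
Definition C_degen (n k : nat) : functor (barC n) (barC n.+1) := Rdegen n k.

Definition D_top (n : nat) : functor (barD n.+1) (barD n) :=
  Smon_mult (barC n) ∘ Smon_map (phi (Rpow n)).

(* d_k for k <= n.+1 *)
Definition D_face (n k : nat) : functor (barD n.+1) (barD n) :=
  if k <= n then Smon_map (C_face n k) else D_top n.

Definition D_degen (n k : nat) : functor (barD n) (barD n.+1) :=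
  Smon_map (C_degen n k).

(* (D_1)_w and _w(C_1) are the homotopy fibres over w of the next two
   functors. *)
Definition D1_to_D0 : functor (barD 1) (barD 0) := D_face 0 0.
Definition C1_to_D0 : functor (barC 1) (barD 0) := D_face 0 1 ∘ Smon_unit (barC 1).

Definition C2_to_D1C1 : functor (barC 2) (prod_groupoid (barD 1) (barC 1)) :=
  pair_functor (D_face 1 2 ∘ Smon_unit (barC 2)) (C_face 1 0).

(* the homotopy sum over w in D_0 of (D_1)_w x _w(C_1), and its projection *)
Definition bar_sum : groupoid := fibre_sum D1_to_D0 C1_to_D0.

Definition bar_sum_proj : functor bar_sum (prod_groupoid (barD 1) (barC 1)) :=
  fibre_sum_proj D1_to_D0 C1_to_D0.

Definition D1C1_to_D1D1 :
    functor (prod_groupoid (barD 1) (barC 1)) (prod_groupoid (barD 1) (barD 1)) :=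
  prod_functor (id_functor (barD 1)) (Smon_unit (barC 1)).

Lemma Smon_eq (X : groupoid) (r r' : Smon X) (e : ext_base r = ext_base r') :
  (forall i : 'I_(ext_base r), ext_sec r i = ext_sec r' (cast_ord e i)) ->
  r = r'.
Proof.
case: r r' e => [n x hx] [n' x' hx'] /= e; case: _ / e x' hx' => x' hx' exx.
have {}exx : x = x'.
  by apply: funext => i; rewrite exx cast_ord_id.
by case: _ / exx hx' => hx'; rewrite (Prop_irrelevance hx hx').
Qed.

(* The simplicial identity d_0 d_2 = d_1 d_0, restricted to C_2 along eta. *)
Lemma bar_square (z : barC 2) :
  D1_to_D0 (C2_to_D1C1 z).1 = C1_to_D0 (C2_to_D1C1 z).2.
Proof.
have e : ext_base (D1_to_D0 (C2_to_D1C1 z).1) =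
  ext_base (C1_to_D0 (C2_to_D1C1 z).2) by [].
by apply: (Smon_eq (e := e)) => p; rewrite cast_ord_id.
Qed.

End Bar.

(* Main.v *)
From mathcomp Require Import all_boot order boolp.
Require Import Defs.

(* Both sides are the homotopy pullback of [D1_to_D0] and [C1_to_D0]. For any
   [f : X -> B] and [g : Y -> B] the sum over [b] of the products of the
   homotopy fibres is the homotopy pullback: [(b, (x, gamma), (y, delta))] goes
   to [(x, y, delta^-1 gamma)], and [b] is recovered up to isomorphism as [f x].
   An object of [C_2] is an operation with an operation plugged into each of
   its inputs, that is, a sequence of operations together with an operation
   whose sequence of input colours matches the sequence of output colours; in
   the homotopy pullback the matching is up to a permutation, which can be used
   to reorder the sequence of operations. *)

Set Implicit Arguments.
Unset Strict Implicit.
Unset Printing Implicit Defensive.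

(** * Cancellation in groupoids, and a criterion for equivalences *)

Lemma comp_injr (C : groupoid) (x y z : C) (g : hom x y) :
  injective (fun h : hom y z => comp h g).
Proof.
by move=> h h' /(congr1 (comp^~ (inv g))); rewrite -!compA !minv !compm1.
Qed.

Lemma comp_injl (C : groupoid) (x y z : C) (g : hom y z) :
  injective (fun h : hom x y => comp g h).
Proof.
by move=> h h' /(congr1 (comp (inv g))); rewrite !compA !invm !comp1m.
Qed.

Section FullyFaithful.
Variables (C D : groupoid) (F : functor C D).

Definition faithful : Prop := forall x y : C, injective (@fhom _ _ F x y).

Definition full : Prop :=
  forall (x y : C) (g : hom (F x) (F y)), exists f : hom x y, fhom F f = g.

Definition essentially_surjective : Prop :=
  forall y : D, exists x : C, inhabited (hom (F x) y).

(** Preimages of objects and arrows are chosen; faithfulness reduces functoriality and naturality of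
    these choices to equations in [D]. *)
Lemma full_faithful_is_equivalence :
  faithful -> full -> essentially_surjective -> is_equivalence F.
Proof.
move=> faithF fullF surjF.
pose pre y : {x : C & hom (F x) y} :=
  existT (fun x => hom (F x) y) _ (inhabited_witness (projT2 (cid (surjF y)))).
pose eps y : hom (F (projT1 (pre y))) y := projT2 (pre y).
pose lift x y (g : hom (F x) (F y)) : hom x y := projT1 (cid (fullF x y g)).
have liftE x y (g : hom (F x) (F y)) : fhom F (lift x y g) = g.
  by rewrite /lift; case: cid.
pose G_hom y y' (k : hom y y') :=
  lift _ _ (comp (inv (eps y')) (comp k (eps y))).
have G_hom1 y : G_hom _ _ (idm y) = idm _.
  by apply: faithF; rewrite liftE comp1m invm fhom1.
have G_homM y y' y'' (l : hom y' y'') (k : hom y y') :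
    G_hom _ _ (comp l k) = comp (G_hom _ _ l) (G_hom _ _ k).
  apply: faithF; rewrite fhomM !liftE -!compA.
  by rewrite (compA (eps y')) minv comp1m.
exists (Functor G_hom1 G_homM); split; constructor.
- exists (fun x => lift _ _ (eps (F x))) => x y h; apply: faithF => /=.
  by rewrite !fhomM !liftE (compA (eps _)) minv comp1m.
- exists eps => y y' k /=.
  by rewrite liftE (compA (eps _)) minv comp1m.
Qed.

End FullyFaithful.

Lemma is_equivalence_comp (C D E : groupoid) (G : functor D E)
    (F : functor C D) :
  is_equivalence G -> is_equivalence F -> is_equivalence (G ∘ F).
Proof.
move=> [G' [[a] [b]]] [F' [[c] [d]]]; exists (F' ∘ G'); split; constructor.
- exists (fun x => comp (c x) (fhom F' (a (F x)))) => x y f /=.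
  rewrite -compA -fhomM (nat_comm a (fhom F f)) /= fhomM !compA.
  by rewrite (nat_comm c f).
- exists (fun x => comp (b x) (fhom G (d (G' x)))) => x y f /=.
  rewrite -compA -fhomM (nat_comm d (fhom G' f)) /= fhomM !compA.
  by rewrite (nat_comm b f).
Qed.

(** * Connected components and their chosen representatives *)

Lemma pi0_repr_inj (B : groupoid) (c c' : pi0 B) :
  hom (pi0_repr c) (pi0_repr c') -> c = c'.
Proof.
rewrite /pi0_repr; case: cid => b; case: cid => b' /=.
case: c c' => [P hP] [P' hP'] /= e' e k; apply: eq_exist.
rewrite e e'; apply: funext => x; apply: propext.
by split=> -[l]; constructor; [exact: (comp l (inv k)) | exact: (comp l k)].
Qed.

Definition pi0_class (B : groupoid) (b : B) : pi0 B :=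
  exist _ (fun x => inhabited (hom b x)) (ex_intro _ b erefl).

Lemma pi0_repr_class (B : groupoid) (b : B) :
  inhabited (hom b (pi0_repr (pi0_class b))).
Proof.
rewrite /pi0_repr; case: cid => b' /= e.
have /= -> := congr1 (@^~ b') e.
by constructor; exact: idm.
Qed.

(* The homotopy pullback. *)
Section IsoComma.
Variables (X Y B : groupoid) (f : functor X B) (g : functor Y B).
Local Notation XY := (prod_groupoid X Y).

Definition iso_comma_hom (u v : {p : XY & hom (f p.1) (g p.2)}) : Type :=
  {a : hom (projT1 u) (projT1 v) |
     comp (fhom g a.2) (projT2 u) = comp (projT2 v) (fhom f a.1)}.

Lemma iso_comma_hom_eq u v (a b : iso_comma_hom u v) : sval a = sval b -> a = b.
Proof. by case: a b => [a ha] [b hb] /= e; apply: eq_exist. Qed.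

Lemma iso_comma_id_subproof (u : {p : XY & hom (f p.1) (g p.2)}) :
  comp (fhom g (idm (projT1 u)).2) (projT2 u) =
  comp (projT2 u) (fhom f (idm (projT1 u)).1).
Proof. by rewrite /= !fhom1 comp1m compm1. Qed.

Lemma iso_comma_comp_subproof u v w (b : iso_comma_hom v w)
    (a : iso_comma_hom u v) :
  comp (fhom g (comp (sval b) (sval a)).2) (projT2 u) =
  comp (projT2 w) (fhom f (comp (sval b) (sval a)).1).
Proof. by rewrite /= !fhomM -compA (svalP a) !compA (svalP b). Qed.

Lemma iso_comma_inv_subproof u v (a : iso_comma_hom u v) :
  comp (fhom g (inv (sval a)).2) (projT2 v) =
  comp (projT2 u) (fhom f (inv (sval a)).1).
Proof.
apply: (@comp_injl _ _ _ _ (fhom g (sval a).2)).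
apply: (@comp_injr _ _ _ _ (fhom f (sval a).1)).
by rewrite /= !compA -fhomM minv fhom1 comp1m -!compA -fhomM invm fhom1 compm1
  (svalP a).
Qed.

Definition iso_comma : groupoid.
Proof.
refine (@Groupoid {p : XY & hom (f p.1) (g p.2)} iso_comma_hom
  (fun u => exist _ _ (iso_comma_id_subproof u))
  (fun u v w b a => exist _ _ (iso_comma_comp_subproof b a))
  (fun u v a => exist _ _ (iso_comma_inv_subproof a)) _ _ _ _ _).
- abstract (by move=> u v a; apply: iso_comma_hom_eq; apply: comp1m).
- abstract (by move=> u v a; apply: iso_comma_hom_eq; apply: compm1).
- abstract (by move=> *; apply: iso_comma_hom_eq; apply: compA).
- abstract (by move=> u v a; apply: iso_comma_hom_eq; apply: invm).
- abstract (by move=> u v a; apply: iso_comma_hom_eq; apply: minv).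
Defined.

Section Lift.
Variables (Z : groupoid) (Q : functor Z XY).
Variable (cell : forall z, hom (f (Q z).1) (g (Q z).2)).
Hypothesis cellN : forall z z' (a : hom z z'),
  comp (fhom g (fhom Q a).2) (cell z) = comp (cell z') (fhom f (fhom Q a).1).

Definition iso_comma_lift_ob z : iso_comma := existT _ (Q z) (cell z).

Definition iso_comma_lift_hom z z' (a : hom z z') :
    hom (iso_comma_lift_ob z) (iso_comma_lift_ob z') :=
  exist _ (fhom Q a) (cellN a).

Lemma iso_comma_lift1 z : iso_comma_lift_hom (idm z) = idm _.
Proof. by apply: iso_comma_hom_eq; apply: fhom1. Qed.

Lemma iso_comma_liftM z z' z'' (b : hom z' z'') (a : hom z z') :
  iso_comma_lift_hom (comp b a) =
  comp (iso_comma_lift_hom b) (iso_comma_lift_hom a).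
Proof. by apply: iso_comma_hom_eq; apply: fhomM. Qed.

(** The universal property of the homotopy pullback: [Q] together with a natural [cell] is a functor
    into it. *)
Definition iso_comma_lift : functor Z iso_comma :=
  Functor iso_comma_lift1 iso_comma_liftM.

End Lift.

(** The automorphism [h] of the representative acts on [ga] and [de] alike, so it cancels in
    [comp (inv de) ga]. *)
Lemma fibre_sum_cellN (u v : fibre_sum f g) (a : hom u v) :
  comp (fhom g (fhom (fibre_sum_proj f g) a).2) (fibre_sum_cell u) =
  comp (fibre_sum_cell v) (fhom f (fhom (fibre_sum_proj f g) a).1).
Proof.
case: u v a => [c [[x ga] [y de]]] [c' v] [/= e]; case: _ / e v => v.
case: v => [[x' ga'] [y' de']] [h [[/= a ha] [/= b hb]]].
rewrite /fibre_sum_cell /=.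
apply: (@comp_injl _ _ _ _ de'); rewrite !compA hb minv comp1m ha.
by rewrite -!compA (compA de) minv comp1m.
Qed.

Definition fibre_sum_to_iso_comma : functor (fibre_sum f g) iso_comma :=
  iso_comma_lift fibre_sum_cellN.

(** The pair [(a, b)] already determines [h]: the fibre condition [ha] equates [comp h ga] with
    [comp ga' (fhom f a)], and [ga] is invertible. *)
Lemma fibre_sum_to_iso_comma_faithful : faithful fibre_sum_to_iso_comma.
Proof.
move=> [c [[x ga] [y de]]] [c' v] [/= e]; case: _ / e v => v.
case: v => [[x' ga'] [y' de']] [h [[/= a ha] [/= b hb]]].
move=> [e [h' k']]; rewrite (Prop_irrelevance e erefl) /= in h' k' *.
case: k' => -[/= a' ha'] [/= b' hb'] /(congr1 sval) [ea eb].
subst a' b'; have eh : h = h' by apply: (@comp_injr _ _ _ _ ga); rewrite -ha.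
case: _ / eh ha' hb' => ha' hb'.
by rewrite (Prop_irrelevance ha ha') (Prop_irrelevance hb hb').
Qed.

(** The condition on [a] forces the automorphism to be [ga' f(a) ga^-1]; the square [sq] then yields
    the condition on [b]. *)
Lemma fibre_sum_to_iso_comma_full : full fibre_sum_to_iso_comma.
Proof.
move=> [c [[x ga] [y de]]] [c' [[x' ga'] [y' de']]] [[/= a b] /= sq].
have e : c = c'.
  by apply: pi0_repr_inj; apply: (comp ga' (comp (fhom f a) (inv ga))).
case: _ / e ga' de' sq => ga' de' sq.
have ha : comp ga' (fhom f a) = comp (comp (comp ga' (fhom f a)) (inv ga)) ga.
  by rewrite -compA invm compm1.
have hb : comp de' (fhom g b) = comp (comp (comp ga' (fhom f a)) (inv ga)) de.
  apply: (@comp_injr _ _ _ _ (inv de)); apply: (@comp_injr _ _ _ _ ga).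
  move: sq; rewrite /fibre_sum_cell /= => /(congr1 (comp de')).
  rewrite !compA minv comp1m => <-; rewrite -!compA (compA de) minv comp1m.
  by rewrite (invm ga) compm1.
exists (existT _ erefl (existT _ (comp (comp ga' (fhom f a)) (inv ga))
  (exist _ a ha, exist _ b hb))).
exact: iso_comma_hom_eq.
Qed.

Lemma fibre_sum_to_iso_comma_surjective :
  essentially_surjective fibre_sum_to_iso_comma.
Proof.
move=> [[x y] /= k]; have [l] := pi0_repr_class (f x).
(* With [gamma = l] and [delta = l k^-1], the cell [delta^-1 gamma] is [k]. *)
exists (existT _ (pi0_class (f x))
  (existT _ x l, existT _ y (comp l (inv k)))).
constructor; exists (idm x, idm y); rewrite /fibre_sum_cell /=.
rewrite !fhom1 comp1m compm1.
apply: (@comp_injl _ _ _ _ (comp l (inv k))).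
by rewrite compA minv comp1m -compA invm compm1.
Qed.

Lemma fibre_sum_to_iso_comma_equivalence :
  is_equivalence fibre_sum_to_iso_comma.
Proof.
apply: full_faithful_is_equivalence.
- exact: fibre_sum_to_iso_comma_faithful.
- exact: fibre_sum_to_iso_comma_full.
- exact: fibre_sum_to_iso_comma_surjective.
Qed.

(** The functor [e] is the lift followed by a quasi-inverse [L]. The isomorphism [k] consists of
    arrows of the homotopy pullback: their underlying pairs form [theta], their commuting squares
    the compatibility with cells. *)
Lemma fibre_sum_equivalence (Z : groupoid) (Q : functor Z XY)
    (cell : forall z, hom (f (Q z).1) (g (Q z).2))
    (cellN : forall z z' (a : hom z z'),
       comp (fhom g (fhom Q a).2) (cell z) =
       comp (cell z') (fhom f (fhom Q a).1)) :
  is_equivalence (iso_comma_lift cellN) ->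
  exists e : functor Z (fibre_sum f g), is_equivalence e /\
    exists theta : nat_iso (fibre_sum_proj f g ∘ e) Q, forall z,
      comp (fhom g (theta z).2) (fibre_sum_cell (e z)) =
      comp (cell z) (fhom f (theta z).1).
Proof.
move=> eqU; have [L [iLK [k]]] := fibre_sum_to_iso_comma_equivalence.
exists (L ∘ iso_comma_lift cellN); split.
  apply: is_equivalence_comp => //.
  by exists fibre_sum_to_iso_comma; split=> //; constructor.
unshelve eexists.
  exists (fun z => sval (k (iso_comma_lift cellN z))) => z z' a.
  exact: (congr1 sval (nat_comm k (fhom (iso_comma_lift cellN) a))).
by move=> z; apply: (svalP (k (iso_comma_lift cellN z))).
Qed.

End IsoComma.

(** * Reindexing of sequences and of their arrows *)

Lemma val_hom_of_eq (X : groupoid) (r r' : Smon X) (e : r = r')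
    (i : 'I_(ext_base r)) :
  val (bij_fun (projT1 (hom_of_eq e)) i) = val i.
Proof. by case: _ / e. Qed.

Lemma ext_hom_congr (I J : Type) (P : polynomial I J) (X : over I)
    (r r' : ext P X) (u v : hom r r') : u = v ->
  forall a a' h h', projT2 u a a' h = projT2 v a a' h'.
Proof. by move=> -> a a' h h'; rewrite (Prop_irrelevance h h'). Qed.

(* [Smon_mult] after [Smon_unit] produces sequences indexed by
   ['I_(\sum_(i < 1) n)], which is only in bijection with ['I_n]. *)
Section SingleBlock.
Variable n : nat.
Local Notation k := (fun _ : 'I_1 => n).

Definition single_block (p : 'I_(\sum_i k i)) : 'I_n := @tagnat.sig2 _ k p.

Definition single_rank (j : 'I_n) : 'I_(\sum_i k i) := @tagnat.Rank _ k ord0 j.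

Lemma single_blockK : cancel single_block single_rank.
Proof.
move=> p; rewrite /single_rank /single_block.
by rewrite -[in RHS](tagnat.sig2K p) (ord1 (tagnat.sig1 p)).
Qed.

Lemma single_rankK : cancel single_rank single_block.
Proof.
by move=> j; apply: val_inj; rewrite /single_block /single_rank tagnat.Rank2K.
Qed.

End SingleBlock.

(** Transport along [rK] defines [F]; at [s p] it becomes transport along a reflexive equality,
    which is trivial by proof irrelevance. *)
Lemma extend_along_bijection (P E : Type) (s : P -> E) (r : E -> P)
    (T : E -> Type) (H : forall p, T (s p)) :
  cancel s r -> cancel r s ->
  exists F : forall e, T e, forall p, F (s p) = H p.
Proof.
move=> sK rK; exists (fun e => eq_rect _ T (H (r e)) e (rK e)) => p.
by move: (rK (s p)); rewrite sK => e; rewrite (Prop_irrelevance e erefl).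
Qed.

(** * The groupoid [barC R 2] as a homotopy pullback *)

Section BarSquare.
Variable R : operad.

(** Since [barC R 0] is discrete, an arrow of [barD R 0] carries no data besides its permutation. *)
Lemma barD0_hom_eq (r r' : barD R 0) (u v : hom r r') :
  (forall i, bij_fun (projT1 u) i = bij_fun (projT1 v) i) -> u = v.
Proof.
move=> e; apply: ext_hom_eq => [|*]; first exact: bij_eq.
exact: discrete_hom_eq.
Qed.

Lemma barC1_hom_eq (r r' : barC R 1) (u v : hom r r') :
  (forall i, sval (projT1 u) i = sval (projT1 v) i) -> u = v.
Proof.
move=> e; apply: ext_hom_eq => [|*]; first exact: op_hom_eq.
exact: discrete_hom_eq.
Qed.

Lemma bar_square_id (z : barC R 2) i :
  bij_fun (projT1 (hom_of_eq (bar_square z))) i = i.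
Proof. by apply: val_inj; apply: val_hom_of_eq. Qed.

(** Both routes permute the colours by the permutation of the outer operation in [a], and the cells
    permute nothing. *)
Lemma bar_squareN (z z' : barC R 2) (a : hom z z') :
  comp (fhom (C1_to_D0 R) (fhom (C2_to_D1C1 R) a).2)
    (hom_of_eq (bar_square z)) =
  comp (hom_of_eq (bar_square z'))
    (fhom (D1_to_D0 R) (fhom (C2_to_D1C1 R) a).1).
Proof.
apply: barD0_hom_eq => i; apply: val_inj.
apply: (etrans _ (esym (val_hom_of_eq _ _))).
by rewrite -[in RHS](bar_square_id i).
Qed.

Definition barC2_lift := iso_comma_lift bar_squareN.

Lemma D_top_unit_homE (z z' : barC R 2) (a : hom z z') p q h h' :
  projT2 (fhom (C2_to_D1C1 R) a).1 p q h =
  projT2 a (single_block p) (single_block q) h'.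
Proof. by rewrite (Prop_irrelevance h' (block_fun_eq2 h)). Qed.

Lemma D_top_unit_bijE (z z' : barC R 2) (a : hom z z') p :
  single_block (bij_fun (projT1 (fhom (C2_to_D1C1 R) a).1) p) =
  sval (projT1 a) (single_block p).
Proof.
by apply: val_inj; rewrite /single_block /= /block_fun tagnat.Rank2K.
Qed.

Lemma D_top_unit_slot (z z' : barC R 2) (a : hom z z') p q :
  sval (projT1 a) (single_block p) = single_block q ->
  bij_fun (projT1 (fhom (C2_to_D1C1 R) a).1) p = q.
Proof.
by move=> h; apply: (can_inj (@single_blockK _)); rewrite D_top_unit_bijE.
Qed.

(** The [barC R 1] component recovers the arrow of outer operations, the [barD R 1] component the
    arrows between the operations plugged in. *)
Lemma barC2_lift_faithful : faithful barC2_lift.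
Proof.
move=> z z' a a' /(congr1 sval) e.
have e1 := ext_hom_congr (congr1 fst e).
have e2 := congr1 (@projT1 _ _) (congr1 snd e).
apply: ext_hom_eq => // j j' h h'.
move: h h'; rewrite -(single_rankK j) -(single_rankK j') => h h'.
have k := D_top_unit_slot h; have k' := D_top_unit_slot h'.
rewrite -(D_top_unit_homE k) -(D_top_unit_homE k').
exact: e1.
Qed.

Lemma C1_to_D0_bijE (t t' : barC R 1) (b : hom t t') p :
  single_block (bij_fun (projT1 (fhom (C1_to_D0 R) b)) p) =
  sval (projT1 b) (single_block p).
Proof.
by apply: val_inj; rewrite /single_block /= /block_fun tagnat.Rank2K.
Qed.

(** As the cells permute nothing, commutativity in [barD R 0] says that [a] and [b] induce the same
    permutation, up to the reindexing [single_block]. *)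
Lemma bar_square_bij (z z' : barC R 2)
    (a : hom (C2_to_D1C1 R z).1 (C2_to_D1C1 R z').1)
    (b : hom (C2_to_D1C1 R z).2 (C2_to_D1C1 R z').2) :
  comp (fhom (C1_to_D0 R) b) (hom_of_eq (bar_square z)) =
  comp (hom_of_eq (bar_square z')) (fhom (D1_to_D0 R) a) ->
  forall p,
    single_block (bij_fun (projT1 a) p) = sval (projT1 b) (single_block p).
Proof.
move=> sq p.
have e : bij_fun (projT1 (fhom (C1_to_D0 R) b))
      (bij_fun (projT1 (hom_of_eq (bar_square z))) p) =
    bij_fun (projT1 (hom_of_eq (bar_square z'))) (bij_fun (projT1 a) p) :=
  congr1 (fun u => bij_fun (projT1 u) p) sq.
rewrite !bar_square_id in e.
by rewrite -e -C1_to_D0_bijE.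
Qed.

Lemma barC2_lift_full : full barC2_lift.
Proof.
move=> z z' [[a b] /= sq]; have ab := bar_square_bij sq.
pose s := projT1 b.
have a_eq p q :
    sval s (single_block p) = single_block q -> bij_fun (projT1 a) p = q.
  by move=> h; apply: (can_inj (@single_blockK _)); rewrite ab.
(* The components of [a] are indexed by the slots of a one-block sum; [F] reindexes them by the
   input slots of the outer operations. *)
have [F FE] := @extend_along_bijection _ _
  (fun pq => (single_block pq.1, single_block pq.2))
  (fun jj => (single_rank jj.1, single_rank jj.2))
  (fun jj => sval s jj.1 = jj.2 -> hom (ext_sec z jj.1) (ext_sec z' jj.2))
  (fun pq (h : sval s (single_block pq.1) = single_block pq.2) =>
     projT2 a pq.1 pq.2 (a_eq _ _ h))
  ltac:(by case=> p q; rewrite !single_blockK)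
  ltac:(by case=> j j'; rewrite !single_rankK).
pose l : hom z z' := existT _ s (fun j j' h => F (j, j') h); exists l.
apply: iso_comma_hom_eq; apply: (f_equal2 pair); last exact: barC1_hom_eq.
apply: ext_hom_eq => [|p q h h'].
  apply: bij_eq => p; apply: (can_inj (@single_blockK _)).
  by rewrite D_top_unit_bijE ab.
have k : sval s (single_block p) = single_block q by rewrite -ab -h'.
apply: (etrans (@D_top_unit_homE _ _ l p q h k)).
rewrite /= (FE (p, q)) /=.
by congr (projT2 a p q); apply: Prop_irrelevance.
Qed.

Lemma barC2_lift_surjective : essentially_surjective barC2_lift.
Proof.
move=> [[r t] /= c].
(* [ci] sends an input slot of [t] to the position in [r] that [c] matches with it. *)
pose ci : bij (projT1 (ext_base t)) (ext_base r) :=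
  bijM (bijV (projT1 c)) (Bij (@single_rankK _) (@single_blockK _)).
have cE p q : bij_fun (projT1 c) p = q ->
    colour (Rpow R 1) (ext_sec r p) = ext_sec t (single_block q).
  exact: (projT2 c p q).
have src j :
    colour (Rpow R 1) (ext_sec r (ci j)) = op_in (projT2 (ext_base t)) j.
  rewrite -[RHS](ext_src t) -[in RHS](single_rankK j).
  by apply: cE; rewrite /= bijVK.
pose z : barC R 2 :=
  @ExtOb _ _ (op_polynomial R) (Rpow R 1) (ext_base t)
    (fun j => ext_sec r (ci j)) src.
(* Reordering back by the inverse of [c], with identities on the operations, leads from [z] to [r].
   Over [t] the permutation is trivial, so the square reduces to [c] cancelling its inverse. *)
have a : {a : hom (C2_to_D1C1 R z).1 r | projT1 a = bijV (projT1 c)}.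
  unshelve eexists; first exists (bijV (projT1 c)) => p q h /=; last by [].
  apply: (@hom_of_eq (barC R 1) (ext_sec r (ci (single_block p)))
    (ext_sec r q)).
  by congr (ext_sec r); rewrite -h /ci /= single_blockK.
case: a => a aE.
have b : {b : hom (C2_to_D1C1 R z).2 t | projT1 b = idm (ext_base t)}.
  unshelve eexists; first exists (idm (ext_base t)) => j j' h; last by [].
  rewrite -(single_rankK j'); apply: cE => /=.
  by rewrite bijVK -h.
case: b => b bE.
exists z; constructor; exists (a, b).
apply: barD0_hom_eq => p.
transitivity (bij_fun (projT1 (fhom (C1_to_D0 R) b)) p).
  exact: (congr1 (bij_fun (projT1 (fhom (C1_to_D0 R) b))) (bar_square_id p)).
apply: (can_inj (@single_blockK _)); rewrite C1_to_D0_bijE bE /=.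
by rewrite aE bijVK.
Qed.

End BarSquare.

Theorem proposition3p11 (R : operad) :
  exists e : functor (barC R 2) (bar_sum R),
    is_equivalence e /\
    (exists theta : nat_iso (bar_sum_proj R ∘ e) (C2_to_D1C1 R),
       forall z : barC R 2,
         comp (fhom (C1_to_D0 R) (snd (theta z))) (fibre_sum_cell (e z)) =
         comp (hom_of_eq (bar_square z)) (fhom (D1_to_D0 R) (fst (theta z)))) /\
    inhabited (nat_iso (D1C1_to_D1D1 R ∘ bar_sum_proj R ∘ e)
                       (D1C1_to_D1D1 R ∘ C2_to_D1C1 R)).
Proof.
have [|e [eqe [theta thetaE]]] :=
  fibre_sum_equivalence (cellN := @bar_squareN R).
  apply: full_faithful_is_equivalence.
  - exact: barC2_lift_faithful.
  - exact: barC2_lift_full.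
  - exact: barC2_lift_surjective.
exists e; split=> //; split; first by exists theta.
(* Over [D_1 x D_1] the isomorphism is [theta] whiskered with [D1C1_to_D1D1 R]. *)
constructor; exists (fun z => fhom (D1C1_to_D1D1 R) (theta z)) => z z' a.
transitivity (fhom (D1C1_to_D1D1 R)
  (comp (theta z') (fhom (bar_sum_proj R ∘ e) a))).
  by rewrite fhomM.
by rewrite nat_comm fhomM.
Qed.
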